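(* Let $(\mathbf X,\mathbf Y)=\{(X^n,Y^n)\}_{n\ge1}$ be a general correlated source. For any $\varepsilon\in[0,1)$, \[ R_{com}^\varepsilon(\mathbf X|\mathbf Y)=\lim_{\delta\downarrow0}\limsup_{n\to\infty}\frac1n H^{\varepsilon+\delta}(X^n|Y^n)=\lim_{\delta\downarrow0}\limsup_{n\to\infty}\frac1n \tilde H^{\varepsilon+\delta}(X^n|Y^n)=\lim_{\delta\downarrow0}\limsup_{n\to\infty}\frac1n \hat H^{\varepsilon+\delta}(X^n|Y^n). \]
   Context: A general correlated source $(\mathbf X,\mathbf Y)=\{(X^n,Y^n)\}_{n\ge1}$ is an arbitrary sequence of pairs of random variables, $(X^n,Y^n)$ taking values in $\mathcal X^n\times\mathcal Y^n$ where $\mathcal X,\mathcal Y$ are finite or countably infinite, with joint distribution $P_{X^nY^n}$; no stationarity, ergodicity, memorylessness or consistency across $n$ is assumed. All marginal probabilities are assumed positive so conditional distributions are defined everywhere. Logarithms are base 2. One-shot quantities: for a pair $(X,Y)$ on discrete $\mathcal X\times\mathcal Y$ with distribution $P_{XY}$ and a set $\mathcal A\subseteq\mathcal X\times\mathcal Y$ with $P_{XY}(\mathcal A)>0$, let $Q^{\mathcal A}_{XY}(x,y)=P_{XY}(x,y)\mathbf 1[(x,y)\in\mathcal A]/P_{XY}(\mathcal A)$, $Q^{\mathcal A}_Y$ its $Y$-marginal, and $H_{\mathcal A}(X|Y)=\sum_{x,y}Q^{\mathcal A}_{XY}(x,y)\log\frac{Q^{\mathcal A}_Y(y)}{Q^{\mathcal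 A}_{XY}(x,y)}$. Define $H^\varepsilon(X|Y)=\inf\{P_{XY}(\mathcal A)H_{\mathcal A}(X|Y):P_{XY}(\mathcal A)\ge1-\varepsilon\}$, $\tilde H^\varepsilon(X|Y)=\inf\{\sum_{(x,y)\in\mathcal A}P_{XY}(x,y)\log\frac1{P_{X|Y}(x|y)}:P_{XY}(\mathcal A)\ge1-\varepsilon\}$, and $\hat H^\varepsilon(X|Y)=\sum_{i=1}^{i^*}P_{XY}(x_i,y_i)\log\frac1{P_{X|Y}(x_i|y_i)}$, where the pairs of $\mathcal X\times\mathcal Y$ are enumerated as $(x_1,y_1),(x_2,y_2),\dots$ so that $P_{X|Y}(x_i|y_i)$ is nonincreasing in $i$, and $i^*$ is the smallest integer with $\sum_{i=1}^{i^*}P_{XY}(x_i,y_i)\ge1-\varepsilon$. These are applied with $(X,Y)=(X^n,Y^n)$. Coding with common side-information: a code of blocklength $n$ is a pair $(\varphi_n,\psi_n)$ with encoder $\varphi_n:\mathcal X^n\times\mathcal Y^n\to\{0,1\}^*$ such that for each $y^n$ the set of codewords $\{\varphi_n(x^n|y^n):x^n\in\mathcal X^n\}$ is prefix-free, and decoder $\psi_n:\{0,1\}^*\times\mathcal Y^n\to\mathcal X^n$. Its error probability is $\Pr\{\psi_n(\varphi_n(X^n|Y^n),Y^n)\ne X^n\}$ and $\ell_n(x^n|y^n)$ denotes the length of $\varphi_n(x^n|y^n)$. A rate $R$ is $\varepsilon$-achievable if there exist codes with $\limsup_n$ error probability $\le\varepsilon$ and $\limsup_n\frac1n\mathbb E[\ell_n(X^n|Y^n)]\le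 R$; $R^\varepsilon_{com}(\mathbf X|\mathbf Y)$ is the infimum of $\varepsilon$-achievable rates.
   Formalization: The third equality is stated for sources whose pairs can, for every n, be enumerated as a sequence with nonincreasing conditional probability (always so for finite alphabets), and for every such enumeration; for infinite alphabets it may not exist, and then Ĥ is undefined. *)

(* Defs.v *)
From HB Require Import structures.
From mathcomp Require Import all_boot all_order all_algebra.
From mathcomp Require Import all_classical all_reals all_analysis.
Set Implicit Arguments. Unset Strict Implicit. Unset Printing Implicit Defensive.
Import Order.TTheory GRing.Theory Num.Theory.
Local Open Scope classical_set_scope.
Local Open Scope ring_scope.

Section OneShot.
Variables (R : realType) (U V : choiceType) (P : U * V -> R).

Definition log2 (r : R) : R := ln r / ln 2.

Definition prob (A : set (U * V)) : \bar R := \esum_(t in A) (P t)%:E.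

Definition margX (x : U) : R := fine (\esum_(y in [set: V]) (P (x, y))%:E).
Definition margY (y : V) : R := fine (\esum_(x in [set: U]) (P (x, y))%:E).

Definition condXY (x : U) (y : V) : R := P (x, y) / margY y.

Definition QA (A : set (U * V)) (t : U * V) : R :=
  if t \in A then P t / fine (prob A) else 0.
Definition QAY (A : set (U * V)) (y : V) : R :=
  fine (\esum_(x in [set: U]) (QA A (x, y))%:E).

(* H_A(X|Y) (terms with Q^A = 0 contribute 0) *)
Definition HA (A : set (U * V)) : \bar R :=
  \esum_(t in [set: U * V]) (QA A t * log2 (QAY A t.2 / QA A t))%:E.

Definition Heps (eps : R) : \bar R :=
  ereal_inf [set (prob A * HA A)%E | A in [set A | ((1 - eps)%:E <= prob A)%E]].

Definition Htilde (eps : R) : \bar R :=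
  ereal_inf [set \esum_(t in A) (P t * log2 (1 / condXY t.1 t.2))%:E
            | A in [set A | ((1 - eps)%:E <= prob A)%E]].

(* An enumeration (x_1,y_1),(x_2,y_2),... of U x V, given by the rank
   r t = (index of t) - 1 : a bijection of U x V onto an initial segment
   of nat, along which P_{X|Y}(x_i|y_i) is nonincreasing. *)
Definition sorted_enum (r : U * V -> nat) : Prop :=
  injective r /\
  (forall t i, (i < r t)%N -> exists t', r t' = i) /\
  (forall t t', (r t < r t')%N -> condXY t'.1 t'.2 <= condXY t.1 t.2).

Definition istar (r : U * V -> nat) (eps : R) : nat :=
  xget 0%N [set i | ((1 - eps)%:E <= prob [set t | (r t < i)%N])%E /\
                    forall j, ((1 - eps)%:E <= prob [set t | (r t < j)%N])%E ->
                              (i <= j)%N].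

Definition Hhat (r : U * V -> nat) (eps : R) : \bar R :=
  \esum_(t in [set t | (r t < istar r eps)%N])
     (P t * log2 (1 / condXY t.1 t.2))%:E.

End OneShot.

(* Index n : nat stands for blocklength n.+1 (blocklengths n >= 1).   *)
Section Source.
Variables (R : realType) (X Y : countType).

Definition blk (n : nat) : choiceType := (n.+1.-tuple X * n.+1.-tuple Y)%type.

Definition source := forall n : nat, blk n -> R.

Definition is_source (P : source) : Prop :=
  (forall n t, 0 <= P n t) /\
  (forall n, prob (P n) [set: blk n] = 1%E) /\
  (forall n x, (0 < \esum_(y in [set: n.+1.-tuple Y]) (P n (x, y))%:E)%E) /\
  (forall n y, (0 < \esum_(x in [set: n.+1.-tuple X]) (P n (x, y))%:E)%E).

Definition encoder := forall n : nat, n.+1.-tuple X -> n.+1.-tuple Y -> seq bool.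
Definition decoder := forall n : nat, seq bool -> n.+1.-tuple Y -> n.+1.-tuple X.

Definition prefix_free_enc (phi : encoder) : Prop :=
  forall n (y : n.+1.-tuple Y) (x x' : n.+1.-tuple X),
    prefix (phi n x y) (phi n x' y) -> phi n x y = phi n x' y.

Definition err_prob (P : source) (phi : encoder) (psi : decoder) (n : nat) : \bar R :=
  prob (P n) [set t | psi n (phi n t.1 t.2) t.2 != t.1].

Definition avg_len (P : source) (phi : encoder) (n : nat) : \bar R :=
  \esum_(t in [set: blk n]) (P n t * (size (phi n t.1 t.2))%:R)%:E.

Definition achievable (P : source) (eps : R) (rate : R) : Prop :=
  exists (phi : encoder) (psi : decoder),
    prefix_free_enc phi /\
    (limn_esup (err_prob P phi psi) <= eps%:E)%E /\
    (limn_esup (fun n => ((n.+1)%:R^-1)%:E * avg_len P phi n) <= rate%:E)%E.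

Definition Rcom (P : source) (eps : R) : \bar R :=
  ereal_inf [set rate%:E | rate in achievable P eps].

End Source.

(* Main.v *)
Require Import Defs.
From HB Require Import structures.
From mathcomp Require Import finmap ring lra.
From mathcomp Require Import all_boot all_order all_algebra.
From mathcomp Require Import all_classical all_reals all_analysis.
Import Order.TTheory GRing.Theory Num.Theory numFieldNormedType.Exports.
Local Open Scope classical_set_scope.
Local Open Scope ring_scope.

(* Htilde is the pivot: up to additive constants, which vanish after dividing
   by the blocklength, it agrees at a fixed error level with Heps, with Hhat
   and with the least average length of a code.  A code of error e is
   injective on the slices of its set of correctly decoded pairs, so Kraft and
   Gibbs give Htilde e <= average length + 1/ln 2; conversely Shannon-Fano-Elias
   coding of P(.|y) on a near-optimal set, with one flag bit, costs at most
   Htilde e + 4.  Letting the tolerance 1/(k+1) decrease slowly enough with n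
   turns the one-shot codes into a code sequence of limiting error eps. *)

(** * Dyadic intervals, Kraft's inequality and Shannon-Fano-Elias codes *)

Section Words.
Context {R : realType}.
Implicit Types (w : seq bool) (s : seq (seq bool)).

Definition width (l : nat) : R := 2^-1 ^+ l.

Lemma width_gt0 l : 0 < width l.
Proof. by rewrite exprn_gt0// invr_gt0. Qed.

Lemma widthS l : width l.+1 = width l / 2.
Proof. by rewrite /width exprSr. Qed.

Lemma log2_width l : log2 (width l) = - l%:R.
Proof.
rewrite /log2 /width lnXn ?invr_gt0// lnV ?posrE// mulNrn -[ln 2 *+ l]mulr_natl.
by rewrite mulNr mulfK// gt_eqF// ln_gt0// ltr1n.
Qed.

(** Binary fraction 0.w: a word [w] stands for the dyadic interval of length [width (size w)]
    starting at [binval w], and extending a word passes to a subinterval. *)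
Fixpoint binval w : R :=
  if w is b :: w' then (b%:R + binval w') / 2 else 0.

Lemma binval_ge0 w : 0 <= binval w.
Proof. by elim: w => //= b w IH; rewrite divr_ge0// addr_ge0// ler0n. Qed.

Lemma binval_width_le1 w : binval w + width (size w) <= 1.
Proof.
elim: w => [|b w IH] /=; first by rewrite add0r /width expr0.
by rewrite widthS; case: b; rewrite /=; lra.
Qed.

Lemma binval_cat w w' : binval (w ++ w') = binval w + width (size w) * binval w'.
Proof.
elim: w => [|b w IH] /=; first by rewrite add0r /width expr0 mul1r.
by rewrite widthS IH; lra.
Qed.

Lemma prefix_binval w w' : prefix w w' ->
  binval w <= binval w' < binval w + width (size w).
Proof.
move=> /prefixP[s ->]; rewrite binval_cat.
have s0 := binval_ge0 s; have s1 := binval_width_le1 s.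
have sw := width_gt0 (size s); have ww := width_gt0 (size w).
rewrite lerDl mulr_ge0 ?(ltW ww)//= ltrD2l gtr_pMr//; lra.
Qed.

(** The word lists the first [l] binary digits of [u]: compare with 1/2, then apply the doubling map
    and recurse. *)
Lemma exists_binval l (u : R) : 0 <= u < 1 ->
  exists2 w, size w = l & binval w <= u < binval w + width l.
Proof.
elim: l u => [|l IH] u /andP[u0 u1].
  by exists [::] => //=; rewrite u0 add0r /width expr0.
have [uh|uh] := ltP u (2^-1).
  have [|w sw /andP[w1 w2]] := IH (2 * u); first by lra.
  by exists (false :: w); rewrite /= ?sw// widthS; lra.
have [|w sw /andP[w1 w2]] := IH (2 * u - 1); first by lra.
by exists (true :: w); rewrite /= ?sw// widthS; lra.
Qed.

(** Induction on a bound for the lengths: splitting by the first bit and deleting it leaves two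
    prefix-free lists of shorter words, each contributing at most 1/2. *)
Lemma kraft_seq s : uniq s -> {in s &, forall w w', prefix w w' -> w = w'} ->
  \sum_(w <- s) width (size w) <= 1.
Proof.
have [n] := ubnP (\max_(w <- s) size w)%N.
elim: n s => // n IH s sn us pf.
(* The empty word is a prefix of every word, so it can only occur alone. *)
have [e|e] := boolP ([::] \in s).
  have -> : s = [:: [::]].
    have se w : w \in s -> w = [::] by move=> ws; rewrite -(pf [::] w) ?prefix0s.
    case: s us se {sn pf e IH} (e) => // a [|b s] /=.
      by move=> _ /(_ a (mem_head _ _)) ->.
    rewrite inE negb_or => /andP[/andP[/eqP ab _] _] se; case: ab.
    by transitivity ([::] : seq bool); [|symmetry]; apply: se; rewrite !inE eqxx ?orbT.
  by rewrite big_seq1 /width expr0.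
pose tl b := [seq behead w | w <- s & head false w == b].
have tlE b w : w \in s -> head false w == b -> w = b :: behead w.
  by case: w => [|c w] /= ws; [rewrite ws in e|move=> /eqP ->].
have half b : \sum_(w <- s | head false w == b) width (size w) =
    (\sum_(w <- tl b) width (size w)) / 2.
  rewrite /tl big_map big_filter mulr_suml big_seq_cond [RHS]big_seq_cond.
  apply: eq_bigr => w /andP[ws hw]; rewrite {1}(tlE b w ws hw) /=.
  exact: widthS.
have tl1 b : \sum_(w <- tl b) width (size w) <= 1.
  have memtl w : w \in tl b -> b :: w \in s.
    move=> /mapP[v]; rewrite mem_filter => /andP[hv vs] ->.
    by rewrite -(tlE b v).
  (* The length bound is strict, so [n = 0] is treated apart: then [s] has no nonempty word. *)
  have [n0|tlb] : (0 < n)%N \/ tl b = [::].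
  - case: n sn {IH} => [sn|]; last by left.
    right; case E : (tl b) => [|w t] //.
    have ws : b :: w \in s by apply: memtl; rewrite E mem_head.
    have := @leq_bigmax_seq _ s xpredT size (b :: w) ws isT.
    by move: sn; rewrite ltnS leqn0 => /eqP ->.
  - apply: IH.
  - rewrite -(prednK n0) ltnS; apply/bigmax_leqP_seq => w /memtl ws _.
    rewrite -ltnS (prednK n0) -ltnS (leq_ltn_trans _ sn)//.
    exact: (@leq_bigmax_seq _ s xpredT size (b :: w) ws isT).
  - rewrite map_inj_in_uniq ?filter_uniq// => v w.
    rewrite !mem_filter => /andP[hv vs] /andP[hw ws] vw.
    by rewrite (tlE b v)// (tlE b w)// vw.
  - move=> v w /memtl vs /memtl ws vw.
    by have := pf _ _ vs ws; rewrite /= eqxx => /(_ vw) [].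
  - by rewrite tlb big_nil.
rewrite (bigID (fun w => head false w == true)) /= half.
rewrite (eq_bigl (fun w => head false w == false)); last first.
  by move=> w; case: head.
by rewrite half; have := tl1 true; have := tl1 false; lra.
Qed.

(** An [esum] is a supremum over finite subsets, which reduces the bound to lists. The hypothesis
    concludes [x = x'] and so includes injectivity of [c] on [D]. *)
Lemma kraft (T : choiceType) (D : set T) (c : T -> seq bool) :
  (forall x x', D x -> D x' -> prefix (c x) (c x') -> x = x') ->
  (\esum_(x in D) (width (size (c x)))%:E <= 1%:E)%E.
Proof.
move=> pf; apply: ge_ereal_sup => _ [X [finX XD]] <-.
rewrite fsbig_finite//= sumEFin lee_fin.
have XD' x : x \in fset_set X -> D x by rewrite in_fset_set// in_setE => /XD.
rewrite -(big_map c xpredT (fun w => width (size w))); apply: kraft_seq.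
  rewrite map_inj_in_uniq ?fset_uniq// => x x' /XD' Dx /XD' Dx' cx.
  by apply: pf => //; rewrite cx prefix_refl.
by move=> _ _ /mapP[x /XD' Dx ->] /mapP[x' /XD' Dx' ->] /(pf _ _ Dx Dx') ->.
Qed.

(** Take the least [l] with [width l <= p / 2]; minimality costs one bit and the half another. The
    half leaves room for a dyadic interval around the midpoint of an interval of length [p]. *)
Lemma exists_width (p : R) : 0 < p <= 1 ->
  exists l, width l <= p / 2 /\ l%:R <= log2 (1 / p) + 2.
Proof.
move=> /andP[p0 p1].
have ln2 : 0 < ln (2 : R) by rewrite ln_gt0// ltr1n.
have : exists l, width l <= p / 2.
  have : (fun n => width n) @ \oo --> (0 : R).
    by apply: cvg_expr; rewrite ger0_norm ?invr_ge0// invf_lt1// ltr1n.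
  move/cvgr0Pnorm_le => /(_ (p / 2)) [|N _ NP]; first by rewrite divr_gt0.
  by exists N; rewrite (le_trans (ler_norm _))// NP/=.
move=> /ex_minnP[[|l]].
  by rewrite /width expr0 => ? _; exfalso; lra.
move=> wl lmin; exists l.+1; split => //.
have wl' : p / 2 < width l by rewrite ltNge; apply/negP => /lmin; rewrite ltnn.
have : log2 (p / 2 / 2) <= log2 (width l.+1).
  rewrite /log2 ler_pM2r ?invr_gt0// ler_ln ?posrE ?width_gt0 ?divr_gt0//.
  by rewrite widthS; lra.
rewrite log2_width div1r /log2 lnV ?posrE// !ln_div ?posrE ?divr_gt0//.
rewrite !mulrBl divff ?gt_eqF//; lra.
Qed.

(* Shannon-Fano-Elias coding: the word of x spells a dyadic interval inside
   [u x, u x + p x), where u is the cumulative sum of p. *)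
Lemma shannon_fano_elias (T : countType) (p : T -> R) :
  (forall x, 0 <= p x) -> (\esum_(x in [set: T]) (p x)%:E <= 1%:E)%E ->
  exists c : T -> seq bool,
    (forall x, 0 < p x -> (size (c x))%:R <= log2 (1 / p x) + 2) /\
    (forall x x', 0 < p x -> 0 < p x' -> prefix (c x) (c x') -> x = x').
Proof.
move=> p0 p1.
have pE x : (0 <= (p x)%:E)%E by rewrite lee_fin.
(* Symbols are ordered by their [pickle] codes to form the cumulative sums. *)
pose B (x : T) := [set x' : T | (pickle x' < pickle x)%N].
pose u (x : T) := fine (\esum_(x' in B x) (p x')%:E).
have uE x : (u x)%:E = \esum_(x' in B x) (p x')%:E.
  rewrite fineK// ge0_fin_numE ?esum_ge0//.
  apply: le_lt_trans (ltry 1); apply: le_trans p1.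
  by rewrite [leRHS](esumID (B x))// setTI leeDl// esum_ge0.
have u0 x : 0 <= u x by rewrite -lee_fin uE esum_ge0.
have below x D : B x `<=` D -> D x -> 
    ((u x + p x)%:E <= \esum_(x' in D) (p x')%:E)%E.
  move=> BD Dx; rewrite (esumID (B x))// setIidr// EFinD uE leeD//.
  rewrite -[leLHS](esum_set1 (a := fun z => (p z)%:E) (pE x)) [leRHS](esumID [set x])//.
  rewrite setIidr ?leeDl ?esum_ge0// => _ ->; split => //.
  by rewrite /B /= ltnn.
have u1 x : u x + p x <= 1 by rewrite -lee_fin; apply: le_trans p1; exact: below.
have step x x' : (pickle x < pickle x')%N -> u x + p x <= u x'.
  move=> xx'; rewrite -lee_fin uE; apply: below => // z zx.
  exact: ltn_trans zx xx'.
have /choice[c cP] (x : T) : exists w, 0 < p x ->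
    (size w)%:R <= log2 (1 / p x) + 2 /\
    u x < binval w /\ binval w + width (size w) <= u x + p x.
  have [px|] := ltP 0 (p x); last by exists [::].
  have := u1 x; have := u0 x => ux0 ux1.
  (* A dyadic interval of length at most [p x / 2] around the midpoint [u x + p x / 2] stays between
     [u x] and [u x + p x]. *)
  have [|l [wl ll]] := exists_width (p x); first by rewrite px/=; lra.
  have [|w sw /andP[w1 w2]] := exists_binval l (u x + p x / 2); first by lra.
  by exists w => _; rewrite sw; do !split => //; lra.
exists c; split => [x /cP[]//|x x' px px' /prefix_binval /andP[v1 v2]].
(* A prefix makes the two dyadic intervals overlap, while [step] separates them for distinct
   [pickle] codes. *)
have [_ [a b]] := cP _ px; have [_ [a' b']] := cP _ px'.
have w' := width_gt0 (size (c x')).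
clear p1 pE uE below.
by case: (ssrnat.ltngtP (pickle x) (pickle x')) =>
  [/step ?|/step ?|/(pcan_inj (@pickleK T))//]; exfalso; lra.
Qed.

End Words.

(** * Unordered sums of extended reals *)

Section Esum.
Context {R : realType}.
Local Open Scope ereal_scope.

Lemma subset_esum (T : choiceType) (A B : set T) (f : T -> \bar R) :
  A `<=` B -> (forall t, B t -> 0 <= f t) ->
  \esum_(t in A) f t <= \esum_(t in B) f t.
Proof.
move=> AB f0; rewrite [leRHS](esumID A)// setIidr// leeDl// esum_ge0//.
by move=> t [/f0].
Qed.

Lemma esumZl (T : choiceType) (A : set T) (f : T -> \bar R) (r : R) :
  (0 <= r)%R -> (forall t, 0 <= f t) ->
  \esum_(t in A) (r%:E * f t) = r%:E * \esum_(t in A) f t.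
Proof.
move=> r0 f0; have [->|rn0] := eqVneq r 0%R.
  by rewrite mul0e esum1// => t _; rewrite mul0e.
rewrite /esum -ereal_sup_pZl ?lt_neqAle ?r0 1?eq_sym ?rn0//; congr ereal_sup.
rewrite image_comp; apply: eq_imagel => X _ /=.
by rewrite ge0_mule_fsumr.
Qed.

Lemma esum_slices (U V : choiceType) (A : set (U * V)) (f : U * V -> \bar R) :
  (forall t, 0 <= f t) ->
  \esum_(t in A) f t =
  \esum_(y in [set: V]) \esum_(x in [set x | A (x, y)]) f (x, y).
Proof.
move=> f0; rewrite esum_esum//=.
rewrite (reindex_esum ([set: V] `*`` (fun y => [set x | A (x, y)])) A
  (fun k => (k.2, k.1)))//; split => //=.
- by move=> [y x] [_].
- by move=> [y x] [y' x'] _ _ [-> ->].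
- by move=> [x y] Axy; exists (y, x).
Qed.

End Esum.

(** * One-shot comparison of [Htilde] with [Heps], [Hhat] and average code length *)

Section OneShotBounds.
Context {R : realType} {U V : choiceType}.
Variable P : U * V -> R.
Hypothesis P_ge0 : forall t, 0 <= P t.
Hypothesis P_mass : prob P [set: U * V] = 1%E.
Hypothesis margY_pos :
  forall y, (0 < \esum_(x in [set: U]) (P (x, y))%:E)%E.

Let C : R := (ln 2)^-1.

Let ln2_gt0 : 0 < ln 2 :> R.
Proof. by rewrite ln_gt0// ltr1n. Qed.

Let PE t : (0 <= (P t)%:E)%E.
Proof. by rewrite lee_fin. Qed.

Lemma prob_ge0 A : (0 <= prob P A)%E.
Proof. exact: esum_ge0. Qed.

Lemma le_prob A B : A `<=` B -> (prob P A <= prob P B)%E.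
Proof. by move=> AB; exact: subset_esum. Qed.

Lemma prob_le1 A : (prob P A <= 1)%E.
Proof. by rewrite -P_mass; exact: le_prob. Qed.

Lemma prob_fin A : prob P A \is a fin_num.
Proof.
rewrite ge0_fin_numE ?prob_ge0//; exact: le_lt_trans (prob_le1 A) (ltry _).
Qed.

Lemma probC A : (prob P A + prob P (~` A) = 1)%E.
Proof. by rewrite -P_mass /prob [RHS](esumID A)// !setTI. Qed.

Lemma slice_fin (A : set (U * V)) y :
  \esum_(x in [set x | A (x, y)]) (P (x, y))%:E \is a fin_num.
Proof.
rewrite ge0_fin_numE ?esum_ge0//; apply: le_lt_trans (ltry 1).
rewrite -P_mass /prob esum_slices//.
rewrite -[leLHS](esum_set1 (t := y)
  (a := fun y => \esum_(x in [set x | A (x, y)]) (P (x, y))%:E)) ?esum_ge0//.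
apply: (@le_trans _ _ (\esum_(y in [set: V])
  \esum_(x in [set x | A (x, y)]) (P (x, y))%:E)%E).
  by apply: subset_esum => // z _; exact: esum_ge0.
by apply: le_esum => z _; exact: subset_esum.
Qed.

Lemma margYE y : (margY P y)%:E = \esum_(x in [set: U]) (P (x, y))%:E.
Proof. by rewrite fineK//; exact: (slice_fin [set: U * V]). Qed.

Lemma margY_gt0 y : 0 < margY P y.
Proof. by rewrite -lte_fin margYE. Qed.

Lemma esum_margY : (\esum_(y in [set: V]) (margY P y)%:E = 1)%E.
Proof.
by rewrite -P_mass /prob esum_slices//; apply: eq_esum => y _; rewrite margYE.
Qed.

Lemma le_margY x y : P (x, y) <= margY P y.
Proof.
rewrite -lee_fin margYE.
rewrite -[leLHS](esum_set1 (t := x) (a := fun x => (P (x, y))%:E))//.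
exact: subset_esum.
Qed.

Lemma condXY_ge0 x y : 0 <= condXY P x y.
Proof. by rewrite divr_ge0// ltW// margY_gt0. Qed.

Lemma condXY_le1 x y : condXY P x y <= 1.
Proof. by rewrite ler_pdivrMr ?margY_gt0// mul1r le_margY. Qed.

Lemma condXY_gt0 x y : 0 < P (x, y) -> 0 < condXY P x y.
Proof. by move=> p0; rewrite divr_gt0// margY_gt0. Qed.

(** Summand of [Htilde]; [cost] is then the quantity that [Htilde] minimises. *)
Definition info (t : U * V) : R := P t * log2 (1 / condXY P t.1 t.2).

Definition cost (A : set (U * V)) : \bar R := \esum_(t in A) (info t)%:E.

Lemma log2_inv_ge0 (p : R) : 0 <= p <= 1 -> 0 <= log2 (1 / p).
Proof.
move=> /andP[]; rewrite le_eqVlt => /predU1P[<- _|p0 p1].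
  (* For [p = 0] the conventions [1 / 0 = 0] and [ln 0 = 0] give the value 0. *)
  by rewrite invr0 mulr0 /log2 ln0// mul0r.
by rewrite /log2 div1r mulr_ge0 ?invr_ge0 ?(ltW ln2_gt0)// ln_ge0// invf_ge1.
Qed.

Lemma info_ge0 t : 0 <= info t.
Proof.
by rewrite mulr_ge0// log2_inv_ge0// condXY_ge0 condXY_le1.
Qed.

Let infoE t : (0 <= (info t)%:E)%E.
Proof. by rewrite lee_fin info_ge0. Qed.

Lemma cost_ge0 A : (0 <= cost A)%E.
Proof. exact: esum_ge0. Qed.

(* Gibbs' inequality for the sub-probabilities w(.|y) on the slices of A; since
   P(.|y) restricted to A need not have mass 1, it loses the constant C. *)
Lemma cross_entropy (A : set (U * V)) (w : U * V -> R) :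
  (forall t, 0 <= w t) ->
  (forall t, A t -> 0 < P t -> 0 < w t) ->
  (forall y, (\esum_(x in [set x | A (x, y)]) (w (x, y))%:E <= 1)%E) ->
  (cost A <= \esum_(t in A) (P t * log2 (1 / w t))%:E + C%:E)%E.
Proof.
move=> w0 wA w1.
have w_le1 t : A t -> w t <= 1.
  case: t => x y At; rewrite -lee_fin; apply: le_trans (w1 y).
  rewrite -[leLHS](esum_set1 (t := x) (a := fun x => (w (x, y))%:E)) ?lee_fin//.
  by apply: subset_esum => [_ ->|z _] //; rewrite lee_fin.
have mw0 t : 0 <= margY P t.2 * w t by rewrite mulr_ge0// ltW// margY_gt0.
(* Each term is bounded through [ln z < z] at [z = margY * w / P]; the price [C * margY * w] sums to
   at most [C], as each slice of [w] has mass at most 1. *)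
apply: (@le_trans _ _ (\esum_(t in A)
    ((P t * log2 (1 / w t))%:E + C%:E * (margY P t.2 * w t)%:E))%E).
  apply: le_esum => -[x y] At; rewrite -EFinM -EFinD lee_fin /info /=.
  have := P_ge0 (x, y); rewrite le_eqVlt => /predU1P[p0|p0].
    rewrite -p0 !mul0r add0r mulr_ge0// ?invr_ge0 ?(ltW ln2_gt0)//.
    exact: (mw0 (x, y)).
  have wt := wA _ At p0; have m := margY_gt0 y.
  have mwP : 0 < margY P y * w (x, y) / P (x, y) by rewrite divr_gt0// mulr_gt0.
  have := ln_sublinear mwP.
  rewrite !div1r /log2 /condXY invf_div.
  rewrite [ln (_ * w _ / _)]ln_div ?posrE ?mulr_gt0// lnM ?posrE//.
  rewrite lnV ?posrE// ln_div ?posrE// -(ltr_pM2l p0).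
  rewrite mulrCA divff ?gt_eqF// mulr1 => h.
  rewrite -/C !mulrA -(mulrC C) -!mulrA -(mulrC C) !mulrA (mulrC _ C) -mulrA.
  rewrite [X in _ <= X + _](_ : _ = C * (P (x, y) * - ln (w (x, y)))); last by ring.
  rewrite -[X in _ <= _ + X]mulrA -mulrDr ler_pM2l ?invr_gt0//; lra.
rewrite esumD//; last 2 first.
- move=> t At; rewrite lee_fin mulr_ge0// log2_inv_ge0// w0/=; exact: w_le1.
- by move=> t _; rewrite -EFinM lee_fin mulr_ge0// invr_ge0 (ltW ln2_gt0).
rewrite leeD2l// esumZl ?invr_ge0 ?(ltW ln2_gt0)//.
rewrite -[leRHS]mule1 lee_pmul2l ?lte_fin ?invr_gt0// esum_slices; last first.
  by move=> t; rewrite lee_fin.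
rewrite -esum_margY; apply: le_esum => y _ /=.
under eq_esum do rewrite EFinM.
rewrite esumZl ?(ltW (margY_gt0 y))//; last by move=> x; rewrite lee_fin.
by rewrite -[leRHS]mule1 lee_pmul2l ?lte_fin ?margY_gt0.
Qed.

Let sliceP (A : set (U * V)) y : R :=
  fine (\esum_(x in [set x | A (x, y)]) (P (x, y))%:E).

Let slicePE A y :
  (sliceP A y)%:E = \esum_(x in [set x | A (x, y)]) (P (x, y))%:E.
Proof. by rewrite fineK// slice_fin. Qed.

Let sliceP_ge0 A y : 0 <= sliceP A y.
Proof. by rewrite -lee_fin slicePE esum_ge0. Qed.

Let le_sliceP (A : set (U * V)) t : A t -> P t <= sliceP A t.2.
Proof.
case: t => x y At; rewrite -lee_fin slicePE.
rewrite -[leLHS](esum_set1 (t := x) (a := fun x => (P (x, y))%:E))//.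
by apply: subset_esum => // _ ->.
Qed.

Let sliceP_le A y : sliceP A y <= margY P y.
Proof. by rewrite -lee_fin slicePE margYE; exact: subset_esum. Qed.

(** The normalisation by [prob P A] cancels inside the logarithm and against the outer factor,
    leaving only unnormalised slice masses. *)
Let prob_HA A : (0 < prob P A)%E ->
  (prob P A * HA P A = \esum_(t in A) (P t * log2 (sliceP A t.2 / P t))%:E)%E.
Proof.
move=> pA; set p := fine (prob P A).
have p_gt0 : 0 < p by rewrite -lte_fin fineK ?prob_fin.
have frac a b : a / p / (b / p) = a / b.
  by rewrite invf_div mulrA mulfVK// gt_eqF.
have QAYE y : QAY P A y = sliceP A y / p.
  apply: EFin_inj; rewrite mulrC EFinM slicePE -esumZl ?invr_ge0 ?(ltW p_gt0)//.
  rewrite esum_mkcond /QAY fineK.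
    apply: eq_esum => x _; rewrite /QA.
    have -> : ((x, y) \in A) = (x \in [set x | A (x, y)]).
      by apply/idP/idP; rewrite !inE.
    by case: ifP => // _; rewrite -EFinM mulrC.
  have QA0 t : (0 <= (QA P A t)%:E)%E.
    by rewrite lee_fin /QA; case: ifP => // _; rewrite divr_ge0// ltW.
  rewrite ge0_fin_numE ?esum_ge0//.
  apply: (@le_lt_trans _ _ (p^-1%:E * \esum_(x in [set: U]) (P (x, y))%:E)%E).
    rewrite -esumZl ?invr_ge0 ?(ltW p_gt0)//; apply: le_esum => x _.
    rewrite -EFinM lee_fin /QA; case: ifP; first by rewrite mulrC.
    by rewrite mulr_ge0// invr_ge0 ltW.
  by rewrite -margYE -EFinM ltry.
rewrite -(fineK (prob_fin A)) -/p /HA -esumZl ?(ltW p_gt0)//; last first.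
  move=> t; rewrite lee_fin QAYE /QA; case: ifPn => [|_]; last by rewrite mul0r.
  rewrite inE => At; rewrite frac.
  have := P_ge0 t; rewrite le_eqVlt => /predU1P[<-|Pt]; first by rewrite !mul0r.
  apply: mulr_ge0; first by rewrite divr_ge0// ltW.
  rewrite /log2.
  rewrite mulr_ge0 ?invr_ge0 ?(ltW ln2_gt0)// ln_ge0//.
  by rewrite ler_pdivlMr// mul1r le_sliceP.
rewrite [RHS]esum_mkcond; apply: eq_esum => t _; rewrite -EFinM QAYE /QA.
case: ifP => _; last by rewrite mul0r mulr0.
by rewrite frac mulrA [p * _]mulrC mulfVK// gt_eqF.
Qed.

(** The same set serves on both sides: a slice of [A] has mass at most [margY], so the inequality
    holds termwise. *)
Lemma Heps_le_Htilde (e : R) : e < 1 -> (Heps P e <= Htilde P e)%E.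
Proof.
move=> e1; apply: le_ereal_inf_tmp => _ [A /= hA <-].
have pA : (0 < prob P A)%E by apply: lt_le_trans hA; rewrite lte_fin subr_gt0.
apply: ge_ereal_inf; exists (prob P A * HA P A)%E; first by exists A.
rewrite prob_HA//; apply: le_esum => -[x y] At; rewrite lee_fin /=.
have := P_ge0 (x, y); rewrite le_eqVlt => /predU1P[<-|Pt]; first by rewrite !mul0r.
have s0 : 0 < sliceP A y := lt_le_trans Pt (le_sliceP _ _ At).
rewrite ler_pM2l// /log2 ler_pM2r ?invr_gt0// /condXY div1r invf_div.
by rewrite ler_ln ?posrE ?divr_gt0 ?margY_gt0// ler_pM2r ?invr_gt0.
Qed.

(** Gibbs with [w] the conditional law on the slice of [A] turns the right-hand sum into
    [prob P A * HA P A]. *)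
Lemma Htilde_le_Heps (e : R) : e < 1 -> (Htilde P e <= Heps P e + C%:E)%E.
Proof.
move=> e1; rewrite -leeBlDr//; apply: le_ereal_inf_tmp => _ [A /= hA <-].
have pA : (0 < prob P A)%E by apply: lt_le_trans hA; rewrite lte_fin subr_gt0.
suff : (Htilde P e <= prob P A * HA P A + C%:E)%E by rewrite -leeBlDr.
apply: ge_ereal_inf; exists (cost A); first by exists A.
rewrite prob_HA//.
apply: le_trans (@cross_entropy A (fun t => P t / sliceP A t.2) _ _ _) _.
- by move=> t; rewrite divr_ge0.
- by move=> t At Pt; rewrite divr_gt0// (lt_le_trans Pt (le_sliceP _ _ At)).
- move=> y; rewrite (eq_esum (b := fun x => (sliceP A y)^-1%:E * (P (x, y))%:E)%E).
    2: by move=> x _; rewrite -EFinM mulrC.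
  rewrite esumZl ?invr_ge0// -slicePE -EFinM lee_fin.
  (* On a slice of mass zero, division by zero makes all weights zero, which the bound allows. *)
  by have [->|s0] := eqVneq (sliceP A y) 0; rewrite ?mulr0// mulVf.
- rewrite leeD2r// le_eqVlt; apply/orP; left; apply/eqP/eq_esum => t _.
  by rewrite div1r invf_div.
Qed.

(** Gibbs with the Kraft weights on the set of correctly decoded pairs, which has mass at least
    [1 - e]. *)
Lemma Htilde_le_avg_len (e : R) (f : U -> V -> seq bool)
    (g : seq bool -> V -> U) :
  (forall y x x', prefix (f x y) (f x' y) -> f x y = f x' y) ->
  (prob P [set t | g (f t.1 t.2) t.2 != t.1] <= e%:E)%E ->
  (Htilde P e <=
   \esum_(t in [set: U * V]) (P t * (size (f t.1 t.2))%:R)%:E + C%:E)%E.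
Proof.
move=> pf he; pose A := [set t : U * V | g (f t.1 t.2) t.2 == t.1].
have AC : [set t : U * V | g (f t.1 t.2) t.2 != t.1] = ~` A.
  by apply/seteqP; split => t /negP.
have hA : ((1 - e)%:E <= prob P A)%E.
  rewrite EFinB leeBlDr// -(probC A) leeD2l//; last by rewrite -AC.
apply: ge_ereal_inf; exists (cost A); first by exists A.
apply: le_trans (cross_entropy A (fun t => width (size (f t.1 t.2))) _ _ _) _.
- by move=> t; rewrite ltW// width_gt0.
- by move=> t _ _; exact: width_gt0.
(* Prefix-freeness alone yields equal words; correct decoding then makes the symbols equal. *)
- move=> y; apply: (kraft _ _ (fun x => f x y)) => x x' /eqP /= gx /eqP /= gx'.
  by move=> /pf fx; rewrite -gx fx.
rewrite leeD2r//; apply: le_trans (subset_esum _ A _ _ (@subsetT _ _) _).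
  apply: le_esum => t _; rewrite lee_fin.
  have -> : log2 (1 / width (size (f t.1 t.2))) = (size (f t.1 t.2))%:R :> R.
    by rewrite /log2 div1r lnV ?posrE ?width_gt0// mulNr -/(log2 _) log2_width opprK.
  by [].
by move=> t _; rewrite lee_fin mulr_ge0.
Qed.

(** * The greedy set of the sorted enumeration *)

Section Sorted.
Variables (r : U * V -> nat) (e : R).
Hypotheses (r_sorted : sorted_enum P r) (e_gt0 : 0 < e) (e_lt1 : e < 1).

Let B i := [set t | (r t < i)%N].

(** As [e > 0], some finite set has mass above [1 - e]; it lies in an initial segment, so the
    minimum exists and [xget] does not fall back on its default. *)
Let istarP : ((1 - e)%:E <= prob P (B (istar P r e)))%E /\
  forall j, ((1 - e)%:E <= prob P (B j))%E -> (istar P r e <= j)%N.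
Proof.
have [i hi] : exists i, ((1 - e)%:E <= prob P (B i))%E.
  have : ((1 - e)%:E < prob P [set: U * V])%E.
    by rewrite P_mass lte_fin ltrBlDr ltrDl.
  move=> /ereal_sup_gt[_ [X [finX _]] <-] /ltW hX.
  exists (\max_(t <- fset_set X) (r t).+1)%N; apply: (le_trans hX).
  rewrite -esum_fset//; apply: le_prob => t Xt; rewrite /B /=.
  apply: (bigmaxn_sup_seq t) => //.
  by rewrite in_fset_set// inE.
have ex : exists i, `[< ((1 - e)%:E <= prob P (B i))%E >].
  by exists i; apply/asboolP.
rewrite /istar; case: xgetP => [j _ []//|none]; exfalso.
case: (ex_minnP ex) => j /asboolP hj jmin; apply: (none j); split => //.
by move=> k hk; apply: jmin; apply/asboolP.
Qed.

Lemma Htilde_le_Hhat : (Htilde P e <= Hhat P r e)%E.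
Proof.
apply: ge_ereal_inf; exists (Hhat P r e) => //; exists (B (istar P r e)) => //.
by case: istarP.
Qed.

Let cond_le_log2 (t t' : U * V) : 0 < condXY P t.1 t.2 ->
  condXY P t.1 t.2 <= condXY P t'.1 t'.2 ->
  log2 (1 / condXY P t'.1 t'.2) <= log2 (1 / condXY P t.1 t.2).
Proof.
move=> ct ctt'; rewrite /log2 ler_pM2r ?invr_gt0// !div1r.
have ct' := lt_le_trans ct ctt'.
by rewrite ler_ln ?posrE ?invr_gt0// lef_pV2.
Qed.

(* Exchange argument: P(B i) <= P(A), and at the threshold element t0 the
   information density separates the elements of B i from those outside. *)
Let cost_prefix_le (A : set (U * V)) (t0 : U * V) : 0 < P t0 ->
  (prob P (B (r t0)) <= prob P A)%E -> (cost (B (r t0)) <= cost A)%E.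
Proof.
case: r_sorted => r_inj [_ r_cond] Pt0 BA.
have c0 : 0 < condXY P t0.1 t0.2 by case: t0 Pt0 {BA} => x y; exact: condXY_gt0.
set i := r t0 in BA *; set c := log2 (1 / condXY P t0.1 t0.2).
have c_ge0 : 0 <= c by rewrite log2_inv_ge0// ltW//= condXY_le1.
have PBA : (prob P (B i `&` ~` A) <= prob P (A `&` ~` B i))%E.
  move: BA; rewrite /prob (esumID A (B i))// (esumID (B i) A)// (setIC A (B i)).
  by rewrite leeD2lE//; exact: prob_fin.
rewrite /cost (esumID A (B i))// (esumID (B i) A)// (setIC A (B i)) leeD2l//.
apply: (@le_trans _ _ (c%:E * prob P (B i `&` ~` A))%E).
  rewrite -esumZl//; apply: le_esum => t [Bt _]; rewrite -EFinM lee_fin mulrC.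
  by rewrite ler_wpM2l// cond_le_log2// r_cond.
apply: (@le_trans _ _ (c%:E * prob P (A `&` ~` B i))%E).
  by rewrite lee_wpmul2l.
rewrite -esumZl//; apply: le_esum => t [_ /negP Bt]; rewrite -EFinM lee_fin mulrC.
(* A pair of mass zero may violate the density bound but contributes nothing. *)
have := P_ge0 t; rewrite le_eqVlt => /predU1P[Pt|Pt].
  by rewrite /info -Pt !mul0r.
rewrite ler_wpM2l//; move: Bt; rewrite -leqNgt leq_eqVlt => /predU1P[/r_inj <-//|tt].
by apply: cond_le_log2; [case: t Pt {tt} => x y; exact: condXY_gt0|exact: r_cond].
Qed.

(** Without its last pair the greedy segment has mass below [1 - e], so by exchange it costs no more
    than any admissible set; the last pair costs at most [C]. *)
Lemma Hhat_le_Htilde : (Hhat P r e <= Htilde P e + C%:E)%E.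
Proof.
case: r_sorted => r_inj [_ r_cond]; case: istarP; rewrite /Hhat -/(B _).
case: (istar P r e) => [|i] hi imin.
  move: hi; rewrite /B (_ : [set _ | _] = set0) ?/prob ?esum_set0 ?lee_fin.
    by rewrite leNgt subr_gt0 e_lt1.
  by apply/seteqP; split.
have hBi : (prob P (B i) < (1 - e)%:E)%E.
  by rewrite ltNge; apply/negP => /imin; rewrite ltnn.
(* If rank [i] were not taken, [B i] would equal [B i.+1] and already be heavy enough. *)
have [t0 rt0] : exists t0, r t0 = i.
  apply: contrapT => no; move: hBi; rewrite ltNge; apply/negP; rewrite negbK.
  apply: le_trans hi _; apply: le_prob => t; rewrite /B /= ltnS leq_eqVlt.
  by case/predU1P => // rt; case: no; exists t.
have split_last (F : U * V -> \bar R) : (forall t, 0 <= F t)%E ->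
    (\esum_(t in B i.+1) F t = \esum_(t in B i) F t + F t0)%E.
  move=> F0; rewrite (esumID (B i))//; congr (_ + _)%E.
    by congr esum; apply/setIidPr => t; rewrite /B /= => /ltnW.
  rewrite -[RHS](esum_set1 (t := t0) (a := F))//; congr esum.
  apply/seteqP; split => [t [] |_ ->]; rewrite /B /= ?rt0 ?ltnn ?ltnSn//.
  by rewrite ltnS leq_eqVlt => /predU1P[rt _|->//]; apply: r_inj; rewrite rt.
have Pt0 : 0 < P t0.
  rewrite lt_neqAle P_ge0 andbT; apply/negP => /eqP Pt0.
  by move: hi; rewrite /prob split_last// -Pt0 adde0 leNgt hBi.
(* With [m = margY P y], [ln z < z] at [z = m / P] gives [P * ln (m / P) <= m <= 1]. *)
have info0 : info t0 <= C.
  case: t0 {rt0 split_last} Pt0 => x y Pt0.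
  have m := margY_gt0 y; have mP : 0 < margY P y / P (x, y) by rewrite divr_gt0.
  have m1 : margY P y <= 1.
    rewrite -lee_fin -esum_margY -[leLHS](esum_set1 (t := y)
      (a := fun y => (margY P y)%:E)) ?lee_fin ?(ltW m)//.
    by apply: subset_esum => // z _; rewrite lee_fin ltW// margY_gt0.
  rewrite /info /= /condXY div1r invf_div /log2 mulrA -[leRHS]mul1r.
  rewrite ler_pM2r ?invr_gt0//; apply: le_trans m1.
  by rewrite mulrC -ler_pdivlMr// ltW// ln_sublinear.
rewrite split_last//; apply: leeD; last by rewrite lee_fin.
apply: le_ereal_inf_tmp => _ [A /= hA <-]; rewrite -rt0.
by apply: cost_prefix_le => //; rewrite rt0; exact: le_trans (ltW hBi) hA.
Qed.

End Sorted.

End OneShotBounds.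

(** * One-shot codes from near-optimal sets *)

Section DirectCoding.
Context {R : realType} {U : countType} {V : choiceType}.
Variable P : U * V -> R.
Hypothesis P_ge0 : forall t, 0 <= P t.
Hypothesis P_mass : prob P [set: U * V] = 1%E.
Hypothesis margY_pos :
  forall y, (0 < \esum_(x in [set: U]) (P (x, y))%:E)%E.

(** A code exists unconditionally, so one can be chosen at every blocklength; its bounds are claimed
    only for finite [Htilde]. Of the 4 extra bits, 1 is the slack of the near-optimal set, 1 the
    flag and 2 the Shannon-Fano-Elias loss. *)
Lemma exists_code (e : R) : exists (f : U -> V -> seq bool) (g : seq bool -> V -> U),
  (forall y x x', prefix (f x y) (f x' y) -> f x y = f x' y) /\
  (Htilde P e != +oo%E ->
   (prob P [set t | g (f t.1 t.2) t.2 != t.1%PAIR] <= e%:E)%E /\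
   (\esum_(t in [set: U * V]) (P t * (size (f t.1 t.2))%:R)%:E
    <= Htilde P e + 4%:E)%E).
Proof.
have PE t : (0 <= (P t)%:E)%E by rewrite lee_fin.
(* The decoder needs a default symbol; total mass 1 excludes an empty product. *)
have [[x0 y0] _] : exists t : U * V, True.
  apply: contrapT => no; move: P_mass; rewrite /prob.
  rewrite (_ : [set: _] = set0) ?esum_set0; first by move=> [] /eqP; rewrite eq_sym oner_eq0.
  by apply/seteqP; split => // t _; apply: no; exists t.
have [->|Hfin] := eqVneq (Htilde P e) +oo%E.
  by exists (fun _ _ => [::]), (fun _ _ => x0); split => //; rewrite eqxx.
have Hge0 : (0 <= Htilde P e)%E.
  by apply: le_ereal_inf_tmp => _ [A _ <-]; exact: cost_ge0.
have Hfn : Htilde P e \is a fin_num by rewrite ge0_fin_numE// lt_neqAle Hfin leey.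
have [_ [A /= hA <-] /ltW costA] := lb_ereal_inf_adherent (@ltr01 R) Hfn.
rewrite -/(Htilde P e) in costA.
have /choice[c cP] (y : V) : exists c : U -> seq bool,
    (forall x, 0 < condXY P x y ->
       (size (c x))%:R <= log2 (1 / condXY P x y) + 2) /\
    (forall x x', 0 < condXY P x y -> 0 < condXY P x' y ->
       prefix (c x) (c x') -> x = x').
  apply: (shannon_fano_elias _ (fun x => condXY P x y)) => [x|].
    exact: condXY_ge0.
  rewrite (eq_esum (b := fun x => (margY P y)^-1%:E * (P (x, y))%:E)%E).
    2: by move=> x _; rewrite -EFinM mulrC.
  have m : 0 < margY P y by exact: margY_gt0.
  rewrite esumZl ?invr_ge0 ?(ltW m)//.
  by rewrite -margYE// -EFinM mulVf ?gt_eqF//.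
(* Dropping null pairs from [A] loses no mass and keeps only symbols with a coding guarantee. *)
pose D := [set t : U * V | A t /\ 0 < P t].
(* The flag [true] precedes a proper codeword; all pairs outside [D] share one word and may be
   decoded wrongly. *)
pose f x y := if (x, y) \in D then true :: c y x else [:: false].
pose g w y := xget x0 [set x | D (x, y) /\ f x y = w].
have fD x x' y : D (x, y) -> D (x', y) -> prefix (c y x) (c y x') -> x = x'.
  by move=> [_ Pt] [_ Pt']; apply: (cP y).2; exact: condXY_gt0.
exists f, g; split.
  move=> y x x'; rewrite /f; case: ifPn; case: ifPn => //; rewrite ?inE => Dx' Dx /=.
  by move=> /fD -> //.
move=> _; split.
  have sub : [set t : U * V | g (f t.1 t.2) t.2 != t.1] `<=` ~` D.
    move=> [x y] /= /eqP gt Dt; apply: gt; rewrite /g; case: xgetP => [x' _|none].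
      move=> [Dt']; rewrite /f !mem_set// => -[] E.
      by apply: fD Dt' Dt _; rewrite E prefix_refl.
    by case: (none x).
  apply: le_trans (le_prob _ P_ge0 _ _ sub) _.
  rewrite -(@leeD2lE _ (prob P A)); last exact: prob_fin.
  apply: (@le_trans _ _ 1%E); last by rewrite -leeBlDr// -EFinB.
  rewrite -(probC P P_ge0 P_mass A) leeD2l// /prob (esumID A)//.
  rewrite esum1 ?add0e; first by apply: subset_esum => // t [].
  move=> t [] /= nD At; have := P_ge0 t; rewrite le_eqVlt => /predU1P[<-//|Pt].
  by case: nD.
(* The length is at most [log2 (1 / condXY) + 3] on [D] and is 1 elsewhere, so [3 * P t] covers both
   cases. *)
apply: (@le_trans _ _ (\esum_(t in [set: U * V])
    ((if t \in A then (info P t)%:E else 0) + 3%:E * (P t)%:E))%E).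
  apply: le_esum => -[x y] _ /=; rewrite -EFinM.
  have i0 : 0 <= info P (x, y) by exact: info_ge0.
  have Pt0 := P_ge0 (x, y).
  rewrite /f; case: ifPn => [|_].
    rewrite inE => -[At Pt]; rewrite mem_set// -EFinD lee_fin /info /=.
    rewrite [3 * _]mulrC -mulrDr ler_pM2l// -natr1.
    have := (cP y).1 x (condXY_gt0 _ P_ge0 P_mass margY_pos _ _ Pt).
    by lra.
  by case: ifP => _; rewrite ?add0e -?EFinD lee_fin /=; lra.
rewrite esumD//; last 2 first.
- by move=> t _; case: ifP => // _; rewrite lee_fin info_ge0.
- by move=> t _; rewrite -EFinM lee_fin mulr_ge0.
rewrite -esum_mkcond esumZl//; rewrite -/(prob P _) P_mass mule1.
apply: (@le_trans _ _ (Htilde P e + 1 + 3%:E)%E); first by rewrite leeD2r.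
by rewrite -addeA leeD2l// -EFinD lee_fin -(natrD R 1 3).
Qed.

End DirectCoding.

(** * Limits superior of extended real sequences *)

Section LimitSuperior.
Context {R : realType}.
Local Open Scope ereal_scope.
Implicit Types u v : nat -> \bar R.

Lemma limn_esup_lt u (x : \bar R) :
  limn_esup u < x -> \forall n \near \oo, u n < x.
Proof.
rewrite /limn_esup limf_esupE => /ereal_inf_lt[_ [A Aoo <-] Ax].
apply: filterS Aoo => n An; apply: le_lt_trans Ax.
by apply: ereal_sup_ubound; exists n.
Qed.

Lemma limn_esup_le u (x : \bar R) :
  (\forall n \near \oo, u n <= x) -> limn_esup u <= x.
Proof.
move=> ux; rewrite /limn_esup limf_esupE; apply: ge_ereal_inf.
exists (ereal_sup (u @` [set n | u n <= x])); first by exists [set n | u n <= x].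
by apply: ge_ereal_sup => _ [n un <-].
Qed.

Lemma le_of_gt_fin (a b : \bar R) :
  (forall x : R, a < x%:E -> b <= x%:E) -> b <= a.
Proof.
move=> h; rewrite leNgt; apply/negP; move: h.
case: a b => [a| |] [b| |] //= h ab.
- have := h ((a + b) / 2)%R; move: ab; rewrite lte_fin lee_fin lte_fin => ab.
  by clear h => h; have : (b <= (a + b) / 2)%R by [apply: h; lra]; lra.
- by have := h (a + 1)%R; rewrite lte_fin ltrDl ltr01 => /(_ isT).
- by have := h (b - 1)%R (ltNyr _); rewrite lee_fin lerBrDr gerDl ler10.
- by have := h 0%R (ltNyr _).
Qed.

(** The constant divided by the blocklength tends to 0. *)
Lemma limn_esup_scaled_le u v (c : R) :
  (\forall n \near \oo, u n <= v n + c%:E) ->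
  limn_esup (fun n => n.+1%:R^-1%:E * u n) <=
  limn_esup (fun n => n.+1%:R^-1%:E * v n).
Proof.
move=> uv; apply: le_of_gt_fin => x /limn_esup_lt vx.
apply/lee_addgt0Pr => e e0; apply: limn_esup_le.
have n0 n : (0 < n.+1%:R^-1 :> R)%R by rewrite invr_gt0.
have ce : \forall n \near \oo, (n.+1%:R^-1 * c <= e)%R.
  have : (fun n => n.+1%:R^-1 * c)%R @ \oo --> (0 : R)%R.
    by rewrite -(mul0r c); apply: cvgMl; exact: cvg_harmonic.
  move=> /cvgr0Pnorm_le /(_ e e0); apply: filterS => n.
  exact: le_trans (ler_norm _).
near=> n.
have un : u n <= v n + c%:E by near: n.
have vn : n.+1%:R^-1%:E * v n < x%:E by near: n.
have cn : (n.+1%:R^-1 * c <= e)%R by near: n.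
apply: (@le_trans _ _ (n.+1%:R^-1%:E * (v n + c%:E))).
  by rewrite lee_pmul2l// lte_fin.
rewrite muleDr//; last exact: fin_num_adde_defl.
by rewrite leeD// ?ltW// -EFinM lee_fin.
Unshelve. all: by end_near. Qed.

End LimitSuperior.

(** * Converse, direct part and limits for general sources *)

Section Source.
Context {R : realType} {X Y : countType}.
Variable P : source R X Y.
Hypothesis HP : is_source P.
Variable eps : R.
Hypotheses (eps_ge0 : 0 <= eps) (eps_lt1 : eps < 1).

Let C : R := (ln 2)^-1.

Let P_ge0 n t : 0 <= P n t.
Proof. by case: HP. Qed.

Let P_mass n : prob (P n) [set: blk X Y n] = 1%E.
Proof. by case: HP => _ []. Qed.

Let P_margY n y :
  (0 < \esum_(x in [set: n.+1.-tuple X]) (P n (x, y))%:E)%E.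
Proof. by case: HP => _ [_ []]. Qed.

Let F (d : R) : \bar R :=
  limn_esup (fun n => ((n.+1)%:R^-1)%:E * Htilde (P n) (eps + d))%E.

Let le_Htilde n (e e' : R) : e <= e' -> (Htilde (P n) e' <= Htilde (P n) e)%E.
Proof.
move=> ee; apply: ereal_inf_le_tmp => _ [A /= hA <-]; exists A => //=.
by apply: le_trans hA; rewrite lee_fin lerD2l lerN2.
Qed.

Let F_nonincreasing (d d' : R) : d <= d' -> (F d' <= F d)%E.
Proof.
move=> dd; apply: (limn_esup_scaled_le _ _ 0).
by apply: nearW => n; rewrite adde0 le_Htilde// lerD2l.
Qed.

(** Converse: a limiting error of at most [eps] is eventually below [eps + d], so the one-shot bound
    applies at that level. *)
Let F_le_Rcom (d : R) : 0 < d -> (F d <= Rcom P eps)%E.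
Proof.
move=> d0; apply: le_ereal_inf_tmp => _ [rho [phi [psi [pf [he hl]]]] <-].
apply: le_trans hl; apply: (limn_esup_scaled_le _ _ C).
have /limn_esup_lt : (limn_esup (err_prob P phi psi) < (eps + d)%:E)%E.
  by apply: le_lt_trans he _; rewrite lte_fin ltrDl.
apply: filterS => n /ltW en.
by apply: (Htilde_le_avg_len (P n) _ _ _ (eps + d) (phi n) (psi n)) => // y x x' /pf.
Qed.

(** Direct part: a diagonal choice among one-shot codes. *)
Let achievable_of_gt (rho : R) :
  (forall d, 0 < d -> (F d < rho%:E)%E) -> achievable P eps rho.
Proof.
move=> Frho.
pose good n k := (((n.+1)%:R^-1)%:E * Htilde (P n) (eps + k.+1%:R^-1) < rho%:E)%E.
(* The tolerance 1/(k n + 1) decreases to 0 as slowly as [good] requires. *)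
have /choice[k kP] n : exists k, forall K, (K < n)%N -> good n K ->
    good n k /\ (K <= k)%N.
  (* If no [K] qualifies, 0 is a mere default; by [kK] below this happens for finitely many [n]
     only. *)
  have [ex|no] := pselect (exists K, (K < n)%N && good n K); last first.
    by exists 0%N => K Kn gK; case: no; exists K; rewrite Kn.
  have ub K : (K < n)%N && good n K -> (K <= n)%N by move=> /andP[/ltnW].
  case: (ex_maxnP ex ub) => k /andP[_ gk] kmax; exists k => K Kn gK; split=> //.
  by apply: kmax; rewrite Kn.
have kK K : \forall n \near \oo, good n (k n) /\ (K <= k n)%N.
  have /limn_esup_lt gK : (F K.+1%:R^-1 < rho%:E)%E by apply: Frho.
  near=> n; apply: kP; last by near: n.
  by near: n; exact: nbhs_infty_gt.
pose code n := cid (exists_code (P n) (@P_ge0 n) (P_mass n) (@P_margY n)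
  (eps + (k n).+1%:R^-1)).
pose f n := sval (code n); pose dec n := cid (svalP (code n)).
pose g n := sval (dec n); have fgP n := svalP (dec n).
(* [good] bounds the scaled [Htilde] by the real [rho], which excludes [+oo] and releases the bounds
   of [exists_code]. *)
have finH n : good n (k n) ->
    Htilde (P n) (eps + (k n).+1%:R^-1) != +oo%E.
  rewrite /good; apply: contraTN => /eqP ->.
  by rewrite mulry gtr0_sg ?invr_gt0// mul1e ltNge leey.
exists f, g; split; [|split].
- by move=> n y x x'; case: (fgP n) => + _; apply.
- apply/lee_addgt0Pr => e e0; apply: limn_esup_le.
  have [K Ke] : exists K : nat, K.+1%:R^-1 <= e.
    have := @cvg_harmonic R; move=> /cvgr0Pnorm_le /(_ e e0) [K _ /(_ K (leqnn K))] /= h.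
    by exists K; exact: le_trans (ler_norm _) h.
  apply: filterS (kK K) => n [gn Kn].
  case: (fgP n) => _ /(_ (finH n gn)) [+ _]; move/le_trans; apply.
  rewrite -EFinD lee_fin lerD2l; apply: le_trans Ke.
  by rewrite lef_pV2 ?posrE// ler_nat.
- apply: (@le_trans _ _ (limn_esup (fun n =>
    ((n.+1)%:R^-1)%:E * Htilde (P n) (eps + (k n).+1%:R^-1))%E)).
    apply: (limn_esup_scaled_le _ _ 4).
    by apply: filterS (kK 0%N) => n [gn _]; case: (fgP n) => _ /(_ (finH n gn)) [].
  by apply: limn_esup_le; apply: filterS (kK 0%N) => n [/ltW].
Unshelve. all: by end_near. Qed.

(** [F] is nonincreasing, so its right limit at 0 is the supremum over [d > 0]. The converse bounds
    it by [Rcom]; conversely every real above it is achievable. *)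
Lemma Htilde_rate_cvg : F d @[d --> 0^'+] --> Rcom P eps.
Proof.
have -> : Rcom P eps = ereal_sup [set F d | d in [set` Interval (BRight 0) (BInfty _ false)]].
  apply/eqP; rewrite eq_le; apply/andP; split; last first.
    by apply: ge_ereal_sup => _ [d + <-]; rewrite /= in_itv/= andbT => /F_le_Rcom.
  apply: le_of_gt_fin => rho Frho; apply: ereal_inf_lbound; exists rho => //.
  apply: achievable_of_gt => d d0; apply: le_lt_trans Frho.
  by apply: ereal_sup_ubound; exists d => //=; rewrite in_itv/= d0.
apply: (@nonincreasing_at_right_cvge R F 0 (BInfty R false)) => // d d' _ _.
exact: F_nonincreasing.
Qed.

(** Levels strictly between 0 and 1 suffice, as [eps + d] lies there for small [d > 0]; the two
    limits superior then coincide. *)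
Lemma rate_cvg_of_close (H : nat -> R -> \bar R) (c : R) :
  (forall n e, 0 < e < 1 -> (H n e <= Htilde (P n) e + c%:E)%E) ->
  (forall n e, 0 < e < 1 -> (Htilde (P n) e <= H n e + c%:E)%E) ->
  (fun d : R => limn_esup (fun n => (((n.+1)%:R^-1)%:E * H n (eps + d)%R)%E))
    @ 0^'+ --> Rcom P eps.
Proof.
move=> HF FH; apply: cvg_trans Htilde_rate_cvg; apply: near_eq_cvg.
have e1 : 0 < 1 - eps by rewrite subr_gt0.
near=> d.
have d0 : 0 < d by near: d; exact: nbhs_right_gt.
have d1 : d < 1 - eps by near: d; exact: nbhs_right_lt.
have ed : 0 < eps + d < 1 by rewrite ltr_wpDl// addrC -ltrBrDr d1.
apply/eqP; rewrite eq_le; apply/andP; split;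
  by apply: (limn_esup_scaled_le _ _ c); apply: nearW => n; auto.
Unshelve. all: by end_near. Qed.

End Source.

(** * The three limit formulas *)

Theorem theorem5 (R : realType) (X Y : countType) (P : source R X Y)
  (HP : is_source P) (eps : R) (Heps0 : 0 <= eps) (Heps1 : eps < 1) :
  ((fun d : R => limn_esup (fun n => (((n.+1)%:R^-1)%:E * Heps (P n) (eps + d))%E))
      @ 0^'+ --> Rcom P eps) /\
  ((fun d : R => limn_esup (fun n => (((n.+1)%:R^-1)%:E * Htilde (P n) (eps + d))%E))
      @ 0^'+ --> Rcom P eps) /\
  (forall r : forall n : nat, blk X Y n -> nat,
     (forall n, sorted_enum (P n) (r n)) ->
     (fun d : R => limn_esup (fun n => (((n.+1)%:R^-1)%:E * Hhat (P n) (r n) (eps + d))%E))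
        @ 0^'+ --> Rcom P eps).
Proof.
have [P_ge0 [P_mass [_ P_margY]]] := HP.
(* One inequality in each comparison is lossless; it is weakened by this nonnegative constant to fit
   the two-sided form. *)
have C_ge0 : (0 <= (ln 2)^-1%:E :> \bar R)%E by rewrite lee_fin invr_ge0 ln_ge0// ler1n.
split; [|split].
- apply: (rate_cvg_of_close P HP eps Heps0 Heps1 (fun n => Heps (P n)) (ln 2)^-1)
    => n e /andP[_ e1].
    rewrite (le_trans (Heps_le_Htilde (P n) (P_ge0 n) (P_mass n) (P_margY n) e e1))//.
    by rewrite leeDl.
  exact: (Htilde_le_Heps (P n) (P_ge0 n) (P_mass n) (P_margY n) e e1).
- exact: (Htilde_rate_cvg P HP).
- move=> r r_sorted.
  apply: (rate_cvg_of_close P HP eps Heps0 Heps1 (fun n => Hhat (P n) (r n)) (ln 2)^-1)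
    => n e /andP[e0 e1].
    exact: (Hhat_le_Htilde (P n) (P_ge0 n) (P_mass n) (P_margY n) (r n) e (r_sorted n) e0 e1).
  rewrite (le_trans (Htilde_le_Hhat (P n) (P_ge0 n) (P_mass n) (r n) e e0))//.
  by rewrite leeDl.
Qed.
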